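(* Let $m$ be a positive even integer, $k$ a positive integer and $s$ an integer, and assume $\gcd(2^{k}+1,2^{m}+1)=1$ and $\gcd(2^{k}+2s+1,2^{m}-1)=1$. Then the polynomial $$x^{2^{k+m}+s2^{m+1}+1}+x^{2^{k+m}+s2^{m}+s+1}+x^{2^{k+m}+2s+1}+x^{s2^{m+1}+2^{m}+2^{k}}+x^{s2^{m+1}+2^{k}+1}+x^{s2^{m}+2^{m}+2^{k}+s}+x^{s2^{m}+2^{k}+s+1}+x^{2^{m}+2^{k}+2s}+x^{2^{k}+2s+1}$$ is a permutation polynomial over $\mathbb{F}_{2^{2m}}$.
   Context: A polynomial $f$ is a permutation polynomial over $\mathbb{F}_{q}$ if $x\mapsto f(x)$ is a bijection of $\mathbb{F}_q$. Integer exponents are understood modulo $2^{2m}-1$, i.e. $x^{d}$ means $x^{d \bmod (2^{2m}-1)}$ (this makes sense also when $s$ is negative). *)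

(* Defs.v *)
From HB Require Import structures.
From mathcomp Require Import all_boot all_order all_algebra.

Set Implicit Arguments.
Unset Strict Implicit.
Unset Printing Implicit Defensive.

Import Order.TTheory GRing.Theory Num.Theory.

Local Open Scope ring_scope.

Definition permutation_polynomial (F : finFieldType) (p : {poly F}) : Prop :=
  bijective (fun x : F => p.[x]).

(* Since 2 ^ (2 * m) - 1 is positive for 0 < m, the remainder (_ %% _)%Z lies
   in [0, 2 ^ (2 * m) - 1[ even for negative d, so `|_|%N only changes type. *)
Definition red_exp (m : nat) (d : int) : nat :=
  `|(d %% (2 ^+ (2 * m) - 1))%Z|%N.

(* The monomial X ^ d, with integer exponent d read modulo 2 ^ (2 * m) - 1. *)
Definition Xexp (F : finFieldType) (m : nat) (d : int) : {poly F} :=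
  'X^(red_exp m d).

Definition nonomial (F : finFieldType) (m k : nat) (s : int) : {poly F} :=
    Xexp F m (2 ^+ (k + m) + s * 2 ^+ m.+1 + 1)
  + Xexp F m (2 ^+ (k + m) + s * 2 ^+ m + s + 1)
  + Xexp F m (2 ^+ (k + m) + 2 * s + 1)
  + Xexp F m (s * 2 ^+ m.+1 + 2 ^+ m + 2 ^+ k)
  + Xexp F m (s * 2 ^+ m.+1 + 2 ^+ k + 1)
  + Xexp F m (s * 2 ^+ m + 2 ^+ m + 2 ^+ k + s)
  + Xexp F m (s * 2 ^+ m + 2 ^+ k + s + 1)
  + Xexp F m (2 ^+ m + 2 ^+ k + 2 * s)
  + Xexp F m (2 ^+ k + 2 * s + 1).

(* Main.v *)
(** Write [q = 2 ^ m], [Q = 2 ^ k] and [y = x ^ q].  For [x != 0] the polynomial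
    takes the value [A * B] with [A = y ^ 2s + x ^ s * y ^ s + x ^ 2s] in [F_q]
    and [B = x * y ^ Q + y * x ^ Q + x ^ (Q + 1)].  As [m] is even, [F_q]
    contains a primitive cube root of unity [w], and with [z = x + w ^ 2 * y]
    the combination [B + w * B ^ q] equals [z ^ (Q + 1)] for [k] even and
    [w ^ 2 * z ^ (q * Q) * z] for [k] odd.  If [x] and [x'] have the same image,
    the quotient of their [B + w * B ^ q] lies in [F_q]; since [2 ^ k + 1]
    (resp. [2 ^ k - 1]) is prime to [q + 1], so does the quotient of their [z],
    whence [x = r * x'] with [r] in [F_q].  Both sides being homogeneous of
    degree [2 ^ k + 2 * s + 1] over [F_q], which is prime to [q - 1],
    [r = 1]. *)

Require Import Defs.
From HB Require Import structures.
From mathcomp Require Import all_boot all_order all_algebra.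
From mathcomp Require Import all_fingroup all_solvable all_field.
From mathcomp Require Import ring zify.

Import Order.TTheory GRing.Theory Num.Theory.

Local Open Scope ring_scope.

(** * Coprimality of exponents of the form [2 ^ n - 1], [2 ^ n + 1] and [3] *)

Lemma exprz_coprime_eq1 (R : unitRingType) (x : R) (a b : int) :
  x \is a GRing.unit -> coprimez a b -> x ^ a = 1 -> x ^ b = 1 -> x = 1.
Proof.
move=> Ux /eqP co_ab xa xb; have [u [v e]] := Bezoutz a b.
rewrite -[x]expr1z -co_ab -e exprzDr // [u * a]mulrC [v * b]mulrC.
by rewrite -!exprz_exp xa xb !exp1rz mulr1.
Qed.

Lemma dvdn_succ_succX_odd (a n : nat) : odd n -> (a.+1 %| (a ^ n).+1)%N.
Proof.
move=> n_odd; rewrite -(odd_double_half n) n_odd add1n.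
elim: n./2 => [|j IHj]; first by rewrite expn1.
rewrite -(dvdn_addl _ (dvdn_mulr (a ^ j.*2.+1) (dvdnn a.+1))).
(* Subtraction-free form of [a ^ (n + 2) + 1 = (a + 1) * (a ^ (n + 1) - a ^ n) + (a ^ n + 1)]. *)
have ->: ((a ^ j.+1.*2.+1).+1 + a.+1 * a ^ j.*2.+1
  = a.+1 * a ^ j.*2.+2 + (a ^ j.*2.+1).+1)%N by rewrite doubleS !expnS; lia.
by rewrite dvdn_addr // dvdn_mulr.
Qed.

(* Modulo a common divisor, [2 ^ (k * m)] is both [1] and [-1]. *)
Lemma coprime_pred_exp2_succ_exp2 (k m : nat) :
  odd k -> coprime (2 ^ k).-1 (2 ^ m).+1.
Proof.
move=> k_odd; have k_gt0 := odd_gt0 k_odd.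
set d := gcdn (2 ^ k).-1 (2 ^ m).+1.
have d1 : (d %| (2 ^ (k * m)).-1)%N.
  by rewrite expnM (dvdn_trans (dvdn_gcdl _ _)) ?dvdn_pred_predX.
have d2 : (d %| (2 ^ (k * m)).+1)%N.
  by rewrite mulnC expnM (dvdn_trans (dvdn_gcdr _ _)) ?dvdn_succ_succX_odd.
have d_2 : (d %| 2)%N.
  rewrite -(dvdn_addr 2 d1).
  have := expn_gt0 2 (k * m).
  by case: (2 ^ (k * m))%N d2 => // j; rewrite addn2.
have d_odd : odd d.
  apply: dvdn_odd (dvdn_gcdl _ _) _.
  rewrite -(prednK k_gt0) expnS mul2n -(prednK (expn_gt0 2 k.-1)) doubleS /=.
  by rewrite odd_double.
move: d_odd; rewrite /coprime -/d.
by case/primeP: (isT : prime 2) => _ /(_ _ d_2) /orP[] /eqP ->.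
Qed.

Lemma dvdn3_pred_exp2 (m : nat) : ~~ odd m -> (3 %| (2 ^ m).-1)%N.
Proof.
move=> m_even; rewrite -(odd_double_half m) (negPf m_even) -mul2n expnM.
exact: (dvdn_pred_predX 4).
Qed.

(** Since [3] divides [2 ^ m - 1], [2 ^ m + 1] is [2] modulo [3]. *)
Lemma coprime3_succ_exp2 (m : nat) : ~~ odd m -> coprime 3 (2 ^ m).+1.
Proof.
move=> /dvdn3_pred_exp2 /dvdnP[j e].
by rewrite -(prednK (expn_gt0 2 m)) e -(addn2 (j * 3)) /coprime gcdnMDl.
Qed.

(** * Frobenius powers and evaluation of the reduced monomials *)

Section NonzeroValues.

Variables (m k : nat) (s : int) (F : finFieldType).
Hypotheses (m_gt0 : (0 < m)%N) (cardF : #|F| = (2 ^ (2 * m))%N).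

Local Notation q := (2 ^ m)%N.
Local Notation Q := (2 ^ k)%N.

Let pchar2 : 2%N \in [pchar F].
Proof. exact: card_finPcharP cardF _. Qed.

Lemma exprqq (x : F) : (x ^+ q) ^+ q = x.
Proof. by rewrite -exprM -expnD addnn -mul2n -cardF expf_card. Qed.

Lemma exprD_exp2 (n : nat) (x y : F) :
  (x + y) ^+ (2 ^ n) = x ^+ (2 ^ n) + y ^+ (2 ^ n).
Proof.
by apply: exprDn_pchar; rewrite pnatX (pnatE _ (isT : prime 2)) pchar2.
Qed.

Lemma exprz_pred_card (x : F) : x != 0 -> x ^ (2 ^+ (2 * m) - 1 : int) = 1.
Proof.
move=> x0; rewrite expfzDr // -exprz_inv expr1z.
have -> : (2 ^+ (2 * m) : int) = Posz (2 ^ (2 * m)).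
  by rewrite -natrX pmulrn intz.
by rewrite -exprnP -cardF expf_card divff.
Qed.

Lemma horner_Xexp (d : int) (x : F) : x != 0 -> (Xexp F m d).[x] = x ^ d.
Proof.
move=> x0; rewrite /Xexp /red_exp hornerXn.
set N : int := 2 ^+ (2 * m) - 1.
have N0 : N != 0.
  rewrite subr_eq0 -natrX pmulrn intz eqz_nat -[X in _ != X](expn0 2).
  by rewrite eqn_exp2l // -lt0n muln_gt0.
have xN : x ^ ((d %/ N)%Z * N) = 1.
  by rewrite mulrC -exprz_exp exprz_pred_card ?exp1rz.
rewrite exprnP gez0_abs ?modz_ge0 // [in RHS](divz_eq d N).
by rewrite (expfzDr (_ * N)) // xN mul1r.
Qed.

(** A reduced exponent [0] would give the value [1] at [0]. It would force [2 ^ (2 * m) - 1], hence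
    its factor [2 ^ m - 1], to divide [d]. *)
Lemma horner0_Xexp (d : int) :
  ~~ ((2 ^+ m - 1 : int) %| d)%Z -> (Xexp F m d).[0] = 0.
Proof.
move=> ndvd; rewrite /Xexp hornerXn expr0n /red_exp absz_eq0.
case: eqP => // /dvdz_mod0P d0; case/negP: ndvd; apply: dvdz_trans d0.
by rewrite mulnC exprM subrX1 dvdz_mulr.
Qed.

(** * Factorisation of the values at nonzero points *)

Definition symm_factor (x : F) : F :=
  (x ^+ q) ^ s * (x ^+ q) ^ s + x ^ s * (x ^+ q) ^ s + x ^ s * x ^ s.

Definition main_factor (x : F) : F :=
  x * (x ^+ q) ^+ Q + x ^+ q * x ^+ Q + x * x ^+ Q.

Lemma horner_nonomial (x : F) : x != 0 ->
  (nonomial F m k s).[x] = symm_factor x * main_factor x.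
Proof.
move=> x0.
have e2 n : x ^ (2 ^+ n : int) = x ^+ (2 ^ n).
  by rewrite -natrX pmulrn intz.
have xs n : x ^ (s * 2 ^+ n) = (x ^+ (2 ^ n)) ^ s.
  by rewrite mulrC -exprz_exp e2.
have x2s : x ^ (2 * s) = x ^ s * x ^ s.
  by rewrite -expfzDr // mulr2n mulrDl mul1r.
have xqs : x ^ (s * 2 ^+ m.+1) = (x ^+ q) ^ s * (x ^+ q) ^ s.
  by rewrite xs expnS mulnC exprM expr2 expfzMl.
rewrite /nonomial !hornerD !horner_Xexp // !expfzDr // !expr1z xqs !xs x2s !e2.
rewrite addnC expnD exprM /symm_factor /main_factor.
by ring.
Qed.

Lemma symm_factor_expq (x : F) : symm_factor x ^+ q = symm_factor x.
Proof.
rewrite /symm_factor !exprD_exp2 !exprMn.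
have sq (y : F) : (y ^ s) ^+ q = (y ^+ q) ^ s by rewrite !exprnP exprzAC.
by rewrite !sq exprqq; ring.
Qed.

(** Dividing by [x ^ (2 * s)] leaves [t ^ 2 + t + 1] with [t = (x ^ (q - 1)) ^ s]. At a root,
    [t ^ 3 = 1]; also [t ^ (q + 1) = 1], so [t = 1], where the form is [1] in characteristic 2. *)
Lemma symm_factor_neq0 (x : F) : ~~ odd m -> x != 0 -> symm_factor x != 0.
Proof.
move=> m_even x0; have y0 : x ^+ q != 0 by rewrite expf_neq0.
have xs0 : x ^ s != 0 by rewrite expfz_neq0.
set t := (x ^+ q / x) ^ s.
have t0 : t != 0 by rewrite expfz_neq0 ?mulf_neq0 ?invr_eq0.
have -> : symm_factor x = (t * t + t + 1) * (x ^ s * x ^ s).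
  by rewrite /symm_factor /t expfzMl -expfV; field.
rewrite !mulf_neq0 //; apply/eqP => t_root.
have t3 : t ^ (3 : int) = 1.
  apply/eqP; rewrite -exprnP -subr_eq0; apply/eqP.
  by transitivity ((t - 1) * (t * t + t + 1)); [ring | rewrite t_root mulr0].
have tq : t ^ (q.+1 : int) = 1.
  rewrite /t exprzAC -exprnP exprS expr_div_n exprqq mulrA divfK // divff //.
  exact: exp1rz.
have t1 : t = 1.
  have Ut : t \is a GRing.unit by rewrite unitfE.
  by apply: exprz_coprime_eq1 Ut _ t3 tq; rewrite coprimezE coprime3_succ_exp2.
move: t_root; rewrite t1 mulr1 (addrr_pchar2 pchar2) add0r => /eqP.
by rewrite oner_eq0.
Qed.

Lemma main_factor_expq (x : F) : main_factor x ^+ q = main_factor (x ^+ q).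
Proof.
by rewrite /main_factor !exprD_exp2 !exprMn ![(_ ^+ Q) ^+ q]exprAC !exprqq.
Qed.

(** Cauchy's theorem gives a unit of order 3; cancelling [u - 1] in [u ^ 3 - 1 = 0] gives the
    quadratic equation. *)
Lemma exists_cube_root : ~~ odd m -> exists w : F, w * w = w + 1.
Proof.
move=> m_even; have := @Cauchy {unit F} 3 [set: _]%G isT.
rewrite card_finField_unit cardF dvdn3_pred_exp2 ?oddM // => /(_ isT) [u _ u3].
have u1 : FinRing.uval u != 1.
  apply/eqP => u1; have e : u = 1%g by apply: val_inj.
  by rewrite e order1 in u3.
exists (FinRing.uval u); apply/eqP; rewrite -subr_eq0 opprD.
rewrite !(oppr_pchar2 pchar2) addrA; apply/eqP.
apply: (@mulfI _ (FinRing.uval u - 1)); first by rewrite subr_eq0.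
rewrite mulr0; transitivity (FinRing.uval u ^+ 3 - 1); first by ring.
by rewrite -FinRing.val_unitX -u3 expg_order subrr.
Qed.

Variable w : F.
Hypothesis w_root : w * w = w + 1.

Let w4 : w * w * (w * w) = w.
Proof.
have e2 : 1 + 1 = 0 :> F := addrr_pchar2 pchar2 1.
have -> : w * w * (w * w) = (w * w) + (1 + 1) * w + 1.
  by rewrite {1 2}w_root; ring.
by rewrite e2 mul0r addr0 w_root -addrA e2 addr0.
Qed.

Let w3 : w * w * w = 1.
Proof.
by rewrite w_root mulrDl w_root mul1r addrAC (addrr_pchar2 pchar2) add0r.
Qed.

Let addw1 : 1 + w = w * w. Proof. by rewrite w_root addrC. Qed.

(** Squaring swaps [w] and [w ^ 2]; with [n = m] even, [w] lies in [F_q]. *)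
Lemma cube_root_exp2 (n : nat) : w ^+ (2 ^ n) = if odd n then w * w else w.
Proof.
elim: n => [|n IHn]; first by rewrite expr1.
by rewrite expnSr exprM IHn /=; case: (odd n); rewrite expr2.
Qed.

(** * The [F_q]-linear change of variable [z = x + w ^ 2 * y] *)

Definition twist (x : F) : F := x + w * w * x ^+ q.

Hypothesis m_even : ~~ odd m.

Lemma twist_expq (x : F) : twist x ^+ q = w * w * (x + w * x ^+ q).
Proof.
rewrite /twist exprD_exp2 !exprMn exprqq cube_root_exp2 (negPf m_even).
by rewrite mulrDr !mulrA w3 mul1r addrC.
Qed.

(** Inverts [twist]: the coefficient of [x] is [1 + w ^ 3 = 0], that of [x ^+ q] is
    [w ^ 2 + w ^ 4 = 1]. *)
Lemma expq_from_twist (x : F) : x ^+ q = twist x + w * twist x ^+ q.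
Proof.
have -> : twist x + w * twist x ^+ q
    = x + w * w * w * x + (w * w + w * w * w * w) * x ^+ q.
  by rewrite twist_expq /twist; ring.
rewrite w3 mul1r (addrr_pchar2 pchar2) add0r mul1r w_root addrAC.
by rewrite (addrr_pchar2 pchar2) add0r mul1r.
Qed.

Lemma twist_eq0 (x : F) : (twist x == 0) = (x == 0).
Proof.
apply/eqP/eqP => [z0|->]; last by rewrite /twist expr0n expn_eq0 /= mulr0 addr0.
have := expq_from_twist x; rewrite z0 expr0n expn_eq0 /= mulr0 addr0 => /eqP.
by rewrite expf_eq0 => /andP[_ /eqP].
Qed.

Lemma twist_main_even (x : F) : ~~ odd k ->
  main_factor x + w * main_factor x ^+ q = twist x * twist x ^+ Q.
Proof.
move=> k_even; rewrite main_factor_expq /main_factor exprqq.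
rewrite {2}/twist exprD_exp2 !exprMn cube_root_exp2 (negPf k_even).
transitivity (x * x ^+ Q + (1 + w) * (x * (x ^+ q) ^+ Q + x ^+ q * x ^+ Q)
  + w * x ^+ q * (x ^+ q) ^+ Q); first by ring.
by rewrite addw1 -[in X in _ + X * _ * _]w4 /twist; ring.
Qed.

(** For [k] odd, the [Q]-th power swaps [w] and [w ^ 2], so [x ^ Q + w ^ 2 * y ^ Q] comes from the
    conjugate [z ^ q], up to the factor [w] that [w ^ 2] compensates. *)
Lemma twist_main_odd (x : F) : odd k ->
  main_factor x + w * main_factor x ^+ q
  = w * w * (twist x * (twist x ^+ q) ^+ Q).
Proof.
move=> k_odd; rewrite main_factor_expq /main_factor exprqq.
rewrite twist_expq !exprMn exprD_exp2 !exprMn cube_root_exp2 k_odd.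
transitivity (x * x ^+ Q + (1 + w) * (x * (x ^+ q) ^+ Q + x ^+ q * x ^+ Q)
  + w * x ^+ q * (x ^+ q) ^+ Q); first by ring.
rewrite addw1 /twist !w4.
(* Coefficients are padded with cubes of [w], so that the expanded product agrees as a polynomial in
   [w]. *)
transitivity (w * w * w * (x * x ^+ Q)
  + w * w * w * (w * w) * (x * (x ^+ q) ^+ Q + x ^+ q * x ^+ Q)
  + w * w * w * (w * w * (w * w)) * (x ^+ q * (x ^+ q) ^+ Q)); last by ring.
by rewrite w4 w3 !mul1r mulrA.
Qed.

Let w0 : w != 0.
Proof. by apply: contra_eq_neq w3 => ->; rewrite mulr0 eq_sym oner_eq0. Qed.

Lemma twist_main_neq0 (x : F) : x != 0 ->
  main_factor x + w * main_factor x ^+ q != 0.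
Proof.
move=> x0; have z0 : twist x != 0 by rewrite twist_eq0.
case: (boolP (odd k)) => k_par.
  by rewrite twist_main_odd // !mulf_neq0 // !expf_neq0.
by rewrite twist_main_even // mulf_neq0 // expf_neq0.
Qed.

Lemma main_factor_neq0 (x : F) : x != 0 -> main_factor x != 0.
Proof.
move=> x0; apply: contra_neq (twist_main_neq0 x x0) => ->.
by rewrite expr0n expn_eq0 mulr0 addr0.
Qed.

Lemma symm_factorZ (r x : F) : r ^+ q = r ->
  symm_factor (r * x) = r ^ s * r ^ s * symm_factor x.
Proof. by move=> rq; rewrite /symm_factor !exprMn rq !expfzMl; ring. Qed.

Lemma main_factorZ (r x : F) : r ^+ q = r ->
  main_factor (r * x) = r ^+ Q * r * main_factor x.
Proof. by move=> rq; rewrite /main_factor !exprMn rq; ring. Qed.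

Lemma expr_pred_exp2 (r : F) (n : nat) :
  r != 0 -> r ^+ (2 ^ n) = r -> r ^+ (2 ^ n).-1 = 1.
Proof.
move=> r0 e; apply: (mulfI r0).
by rewrite -exprS prednK ?expn_gt0 // mulr1.
Qed.

Lemma nonomial_ratio_expq (x x' : F) :
  coprime (2 ^ k).+1 q.+1 -> x != 0 -> x' != 0 ->
  symm_factor x * main_factor x = symm_factor x' * main_factor x' ->
  (twist x / twist x') ^+ q = twist x / twist x'.
Proof.
move=> co_kq x0 x'0 eqf; set r := twist x / twist x'.
have z0 : twist x != 0 by rewrite twist_eq0.
have z'0 : twist x' != 0 by rewrite twist_eq0.
have r0 : r != 0 by rewrite mulf_neq0 ?invr_eq0.
pose comb y := main_factor y + w * main_factor y ^+ q.
have eq_comb : symm_factor x * comb x = symm_factor x' * comb x'.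
  have eqfq : symm_factor x * main_factor x ^+ q
      = symm_factor x' * main_factor x' ^+ q.
    have := congr1 (fun u => u ^+ q) eqf.
    by rewrite /= !exprMn !symm_factor_expq.
  have combE y : symm_factor y * comb y
      = symm_factor y * main_factor y
        + w * (symm_factor y * main_factor y ^+ q).
    by rewrite /comb mulrDr [symm_factor y * (w * _)]mulrCA.
  by rewrite !combE eqf eqfq.
(* [rho = 1] says that [r] lies in [F_q]; in any case [rho ^ (q + 1) = 1], as [r ^ (q ^ 2) = r]. *)
set rho := r ^+ q.-1.
have rqE : r ^+ q = rho * r by rewrite -exprSr prednK ?expn_gt0.
have rho0 : rho != 0 by rewrite expf_neq0.
have rho_q1 : rho ^+ q.+1 = 1.
  by apply: (mulIf r0); rewrite exprSr -mulrA -rqE -exprMn -rqE exprqq mul1r.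
suff rho1 : rho = 1 by rewrite rqE rho1 mul1r.
have [A0 A'0] := (symm_factor_neq0 _ m_even x0, symm_factor_neq0 _ m_even x'0).
have ratioq : (comb x / comb x') ^+ q = comb x / comb x'.
  have -> : comb x / comb x' = symm_factor x' / symm_factor x.
    by apply/eqP; rewrite eqr_div ?twist_main_neq0 // mulrC eq_comb.
  by rewrite expr_div_n !symm_factor_expq.
have Urho : rho \is a GRing.unit by rewrite unitfE.
(* For [k] even, invariance of [r ^ (Q + 1)] under [q]-th powers gives [rho ^ (Q + 1) = 1]. *)
case: (boolP (odd k)) => k_par; last first.
  have ratioE : comb x / comb x' = r * r ^+ Q.
    by rewrite /comb !twist_main_even // expr_div_n mulf_div.
  clearbody rho r.
  apply: (@exprz_coprime_eq1 _ _ Q.+1 q.+1) Urho _ _ rho_q1 => //.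
  apply: (@mulIf _ (r * r ^+ Q)); first by rewrite mulf_neq0 ?expf_neq0.
  rewrite mul1r -[RHS]ratioE -ratioq ratioE exprMn exprAC rqE exprMn.
  rewrite -exprnP exprS.
  by ring.
(* Invariance now reads [r * r ^ (q * Q) = r ^ q * r ^ Q], that is, [rho ^ Q = rho]. *)
have ratioE : comb x / comb x' = r * (r ^+ q) ^+ Q.
  rewrite /comb !twist_main_odd // -mulf_div divff ?mulf_neq0 // mul1r.
  by rewrite !expr_div_n mulf_div.
clearbody rho r.
apply: (@exprz_coprime_eq1 _ _ Q.-1 q.+1) Urho _ _ rho_q1.
  by rewrite coprimezE coprime_pred_exp2_succ_exp2.
apply: expr_pred_exp2 => //.
apply: (@mulIf _ (r * r ^+ Q)); first by rewrite mulf_neq0 ?expf_neq0.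
transitivity (comb x / comb x'); first by rewrite ratioE rqE exprMn; ring.
by rewrite -ratioq ratioE exprMn [(_ ^+ Q) ^+ q]exprAC exprqq rqE; ring.
Qed.

Lemma nonomial_inj_neq0 (x x' : F) :
  coprime (2 ^ k).+1 q.+1 -> coprimez (2 ^+ k + 2 * s + 1) (2 ^+ m - 1) ->
  x != 0 -> x' != 0 ->
  symm_factor x * main_factor x = symm_factor x' * main_factor x' ->
  x = x'.
Proof.
move=> co_kq co_ksm x0 x'0 eqf.
have rq := nonomial_ratio_expq _ _ co_kq x0 x'0 eqf.
set r := twist x / twist x' in rq.
have z'0 : twist x' != 0 by rewrite twist_eq0.
have r0 : r != 0 by rewrite mulf_neq0 ?invr_eq0 ?twist_eq0.
have zE : twist x = r * twist x' by rewrite divfK.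
have yE : x ^+ q = r * x' ^+ q.
  by rewrite expq_from_twist (expq_from_twist x') zE exprMn rq; ring.
have xE : x = r * x' by rewrite -[x]exprqq yE exprMn rq exprqq.
have fx'0 : symm_factor x' * main_factor x' != 0.
  by rewrite mulf_neq0 ?symm_factor_neq0 ?main_factor_neq0.
suff r1 : r = 1 by rewrite xE r1 mul1r.
have Ur : r \is a GRing.unit by rewrite unitfE.
(* Homogeneity trivialises the first power of [r], membership in [F_q] the second. *)
apply: (exprz_coprime_eq1 _ _ _ _ Ur co_ksm).
  have e2 : r ^ (2 ^+ k : int) = r ^+ Q by rewrite -natrX pmulrn intz.
  apply: (mulIf fx'0).
  rewrite mul1r -[RHS]eqf xE symm_factorZ // main_factorZ //.
  by rewrite !expfzDr // e2 expr1z mulr2n mulrDl mul1r expfzDr //; ring.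
by rewrite expfzDr // -exprz_inv expr1z -natrX pmulrn intz -exprnP rq divff.
Qed.

End NonzeroValues.

Theorem theorem3 (m k : nat) (s : int) (F : finFieldType)
    (m_gt0 : (0 < m)%N) (m_even : ~~ odd m) (k_gt0 : (0 < k)%N)
    (cardF : #|F| = (2 ^ (2 * m))%N)
    (gcd_km : gcdn (2 ^ k + 1) (2 ^ m + 1) = 1%N)
    (gcd_ksm : gcdz (2 ^+ k + 2 * s + 1) (2 ^+ m - 1) = 1) :
  permutation_polynomial (nonomial F m k s).
Proof.
have dvd3 : (3 %| (2 ^+ m - 1 : int))%Z.
  have -> : 2 ^+ m - 1 = Posz (2 ^ m).-1.
    by rewrite predn_int ?expn_gt0 // -natrX pmulrn intz.
  exact: dvdn3_pred_exp2.
(* All nine exponents are congruent to [2 ^ k + 2 * s + 1] modulo [2 ^ m - 1], which is prime to it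
   and, being a multiple of [3], not a unit. So no exponent reduces to [0]. *)
have ndvd j d : d = (2 ^+ m - 1) * j + (2 ^+ k + 2 * s + 1) ->
    ~~ ((2 ^+ m - 1 : int) %| d)%Z.
  move=> ->; rewrite rpredDl ?dvdz_mulr //; apply/negP => dvd_e.
  have dvd1 : ((2 ^+ m - 1 : int) %| 1)%Z.
    by rewrite -[X in (_ %| X)%Z]gcd_ksm dvdz_gcd dvd_e dvdzz.
  by have := dvdz_trans dvd3 dvd1.
have f0 : (nonomial F m k s).[0] = 0.
  rewrite /nonomial !hornerD !horner0_Xexp ?addr0 //.
  - by apply: (ndvd 0); ring.
  - by apply: (ndvd 1); ring.
  - by apply: (ndvd s); ring.
  - by apply: (ndvd (s + 1)); ring.
  - by apply: (ndvd (2 * s)); rewrite exprS; ring.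
  - by apply: (ndvd (2 * s + 1)); rewrite exprS; ring.
  - by apply: (ndvd (2 ^+ k)); rewrite exprD; ring.
  - by apply: (ndvd (2 ^+ k + s)); rewrite exprD; ring.
  - by apply: (ndvd (2 ^+ k + 2 * s)); rewrite exprD exprS; ring.
have [w w_root] := exists_cube_root m F cardF m_even.
have co_kq : coprime (2 ^ k).+1 (2 ^ m).+1.
  by rewrite /coprime -(addn1 (2 ^ k)) -(addn1 (2 ^ m)) gcd_km.
have co_ksm : coprimez (2 ^+ k + 2 * s + 1) (2 ^+ m - 1) by apply/eqP.
have fE := horner_nonomial m k s F m_gt0 cardF.
have f_neq0 (x : F) : x != 0 -> (nonomial F m k s).[x] != 0.
  move=> x0; rewrite fE // mulf_neq0 ?symm_factor_neq0 //.
  exact: main_factor_neq0 w_root m_even x x0.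
(* Over a finite field injectivity suffices; [0] is separate, being the only zero of the
   polynomial. *)
apply: injF_bij => x x'.
have [->|x0] := eqVneq x 0; have [->|x'0] := eqVneq x' 0 => //; rewrite ?f0.
- by move/esym/eqP; rewrite (negPf (f_neq0 _ x'0)).
- by move/eqP; rewrite (negPf (f_neq0 _ x0)).
rewrite !fE //.
by apply: nonomial_inj_neq0 w_root m_even _ _ co_kq co_ksm x0 x'0.
Qed.
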